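(* Let $N_e$ be the number of shots performed for subcircuit configuration $e=1,\dots,E$, let $N=\sum_{e=1}^{E}N_e$ be the total number of shots, and let $\mathrm{Err}=\sum_{e=1}^{E}\frac{1}{N_e}f_e(P,\Theta)$ be the error function, with $f_e(P,\Theta)$ the variance coefficient of configuration $e$. Then, by the Cauchy–Schwarz inequality, $$N\times\mathrm{Err}\;\ge\;\Bigl(\sum_{e=1}^{E}\sqrt{f_e(P,\Theta)}\Bigr)^2 .$$ Treating the $f_e(P,\Theta)$ as constants (which is the case for a given $\Theta$), the error function is inversely proportional to the total number of shots. Equality holds only when the corresponding vectors $(\sqrt{N_e})_e$ and $(\sqrt{f_e(P,\Theta)/N_e})_e$ are linearly dependent, specifically when for each configuration $e$ $$\frac{\sqrt{N_e}}{\sqrt{f_e(P,\Theta)/N_e}}=\frac{N_e}{\sqrt{f_e(P,\Theta)}}=\text{const}.$$ Therefore, with the total number of shots $N$ fixed, the optimal shot distribution (the one minimizing $\mathrm{Err}$) is given for each configuration $e$ by $$N_e=N\times\frac{\sqrt{f_e(P,\Theta)}}{\sum_{e'=1}^{E}\sqrt{f_{e'}(P,\Theta)}}.$$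
   Context: In quantum circuit cutting, a circuit is partitioned into subcircuits, each of which is run in several configurations (choices of measurement bases and preparation states at the cut locations); in total there are $E$ configurations, simulated separately, configuration $e$ with $N_e$ shots. The outcome probabilities of the original circuit are reconstructed from the estimated outcome probabilities $P$ of the configurations, using cut parameters $\Theta$ (adjustable parameters of the decomposition used at each cut). The error function $\mathrm{Err}$ is the total variance of the reconstructed outcome probabilities, which for sufficiently many shots is approximated as $\mathrm{Err}=\sum_{e=1}^{E}\frac{1}{N_e}f_e(P,\Theta)$. Here the coefficients $f_e(P,\Theta)$, obtained by propagation of uncertainty, depend on $P$ and $\Theta$ but not on the shot numbers; $\frac{1}{N_e}f_e(P,\Theta)$ is the contribution of configuration $e$ to the total variance. *)

(* Defs.v *)
From HB Require Import structures.
From mathcomp Require Import all_boot all_order all_algebra.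

Set Implicit Arguments.
Unset Strict Implicit.
Unset Printing Implicit Defensive.

Import Order.TTheory GRing.Theory Num.Theory.
Local Open Scope ring_scope.

(* Shot numbers are real-valued, because the optimal distribution is not      *)
(* integral in general; integral shot numbers are a special case. The types   *)
(* TP and TTheta of the outcome probabilities and of the cut parameters are   *)
(* arbitrary: the coefficients f only need to be independent of the shots.    *)

Definition totalShots (R : rcfType) (E : nat) (n : 'I_E -> R) : R :=
  \sum_(e < E) n e.

Definition Err (R : rcfType) (E : nat) (TP TTheta : Type)
    (f : 'I_E -> TP -> TTheta -> R) (n : 'I_E -> R)
    (P : TP) (Theta : TTheta) : R :=
  \sum_(e < E) 1 / n e * f e P Theta.

(* Every configuration gets a positive number of shots, except that one whose *)
(* variance coefficient vanishes may also be left out; its term in Err is     *)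
(* then 1 / 0 * 0 = 0. If all coefficients are positive, this just says that  *)
(* all the n e are positive. Without the exception there would be no minimizer*)
(* of Err when some, but not all, coefficients vanish.                        *)
Definition admissible (R : rcfType) (E : nat) (TP TTheta : Type)
    (f : 'I_E -> TP -> TTheta -> R) (P : TP) (Theta : TTheta)
    (n : 'I_E -> R) : Prop :=
  forall e, 0 < n e \/ (n e = 0 /\ f e P Theta = 0).

Definition optimalShots (R : rcfType) (E : nat) (TP TTheta : Type)
    (f : 'I_E -> TP -> TTheta -> R) (P : TP) (Theta : TTheta)
    (N : R) (n : 'I_E -> R) : Prop :=
  [/\ admissible f P Theta n,
      totalShots n = N &
      forall m : 'I_E -> R, admissible f P Theta m -> totalShots m = N ->
        Err f n P Theta <= Err f m P Theta].

Definition linearlyDependent (R : rcfType) (E : nat) (u v : 'rV[R]_E) : Prop :=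
  ~~ free [:: u; v].

(* Main.v *)
Require Import Defs.
From HB Require Import structures.
From mathcomp Require Import all_boot all_order all_algebra.
From mathcomp Require Import ring.

Set Implicit Arguments.
Unset Strict Implicit.
Unset Printing Implicit Defensive.

Import Order.TTheory GRing.Theory Num.Theory.
Local Open Scope ring_scope.

(** The Cauchy-Schwarz defect is an explicit weighted sum of squares: with
    [T := totalShots n], [D := Err f n P Theta], [s e := sqrt (f e)] and
    [S := \sum_e s e],
      [T * (T * D - S ^+ 2) = \sum_e (S * n e - T * s e) ^+ 2 / n e].
    Hence [S ^+ 2 <= T * D], with equality iff [S * n e = T * s e] for all [e].
    Linear dependence, constancy of the ratios and optimality are all
    reformulations of this last condition. *)

Lemma admissible_ge0 (R : rcfType) (E : nat) (TP TTheta : Type)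
    (f : 'I_E -> TP -> TTheta -> R) (P : TP) (Theta : TTheta) (n : 'I_E -> R) :
  admissible f P Theta n -> forall e, 0 <= n e.
Proof. by move=> adm e; case: (adm e) => [/ltW //|[-> _]]. Qed.

(** Where [n e] is 0, admissibility makes the coefficient vanish as well, so no division by zero
    spoils the identity. The products are the terms of the inner product of the two Cauchy-Schwarz
    vectors. *)
Lemma mul_sqrt_div (R : rcfType) (E : nat) (TP TTheta : Type)
    (f : 'I_E -> TP -> TTheta -> R) (P : TP) (Theta : TTheta) (n : 'I_E -> R) :
  admissible f P Theta n ->
  forall e, Num.sqrt (n e) * Num.sqrt (f e P Theta / n e)
            = Num.sqrt (f e P Theta).
Proof.
move=> adm e; rewrite -sqrtrM; last exact: admissible_ge0 adm e.
case: (adm e) => [n_gt0|[-> ->]]; last by rewrite mul0r.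
by rewrite mulrC divfK // gt_eqF.
Qed.

Lemma defect_sum_squares (R : rcfType) (E : nat) (TP TTheta : Type)
    (f : 'I_E -> TP -> TTheta -> R) (P : TP) (Theta : TTheta) (n : 'I_E -> R) :
  (forall e, 0 <= f e P Theta) -> admissible f P Theta n ->
  let S := \sum_(e < E) Num.sqrt (f e P Theta) in
  let T := totalShots n in
  T * (T * Err f n P Theta - S ^+ 2)
  = \sum_(e < E) (S * n e - T * Num.sqrt (f e P Theta)) ^+ 2 / n e.
Proof.
move=> f_ge0 adm S T.
have -> : \sum_(e < E) (S * n e - T * Num.sqrt (f e P Theta)) ^+ 2 / n e
  = \sum_(e < E) (S ^+ 2 * n e - (S * T *+ 2) * Num.sqrt (f e P Theta)
                  + T ^+ 2 * (1 / n e * f e P Theta)).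
  apply: eq_bigr => e _; case: (adm e) => [n_gt0|[-> ->]].
    (* Writing the coefficient as the square of [s] leaves a rational identity in [s] and [n e]. *)
    have := sqr_sqrtr (f_ge0 e); move: (Num.sqrt _) => s <-; field.
    by rewrite gt_eqF.
  by rewrite sqrtr0 invr0 !mulr0 subr0 addr0.
rewrite big_split sumrB /= -!mulr_sumr -/S -/(totalShots n) -/T.
rewrite -/(Err f n P Theta); ring.
Qed.

Lemma totalShots_ge0 (R : rcfType) (E : nat) (n : 'I_E -> R) :
  (forall e, 0 <= n e) -> 0 <= totalShots n.
Proof. by move=> n_ge0; apply: sumr_ge0 => e _. Qed.

Lemma totalShots_eq0 (R : rcfType) (E : nat) (n : 'I_E -> R) :
  (forall e, 0 <= n e) -> totalShots n = 0 -> forall e, n e = 0.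
Proof. by move=> n_ge0 T0 e; apply: (psumr_eq0P _ T0). Qed.

Lemma admissible_sqrt_eq0 (R : rcfType) (E : nat) (TP TTheta : Type)
    (f : 'I_E -> TP -> TTheta -> R) (P : TP) (Theta : TTheta) (n : 'I_E -> R) :
  admissible f P Theta n ->
  forall e, n e = 0 -> Num.sqrt (f e P Theta) = 0.
Proof.
by move=> adm e n0; rewrite -(mul_sqrt_div adm e) n0 sqrtr0 mul0r.
Qed.

Lemma shots_err_ge (R : rcfType) (E : nat) (TP TTheta : Type)
    (f : 'I_E -> TP -> TTheta -> R) (P : TP) (Theta : TTheta) (n : 'I_E -> R) :
  (forall e, 0 <= f e P Theta) -> admissible f P Theta n ->
  (\sum_(e < E) Num.sqrt (f e P Theta)) ^+ 2
  <= totalShots n * Err f n P Theta.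
Proof.
move=> f_ge0 adm; have n_ge0 := admissible_ge0 adm.
have := totalShots_ge0 n_ge0; rewrite le_eqVlt => /predU1P[T0|T_gt0].
  (* The defect identity carries a factor [totalShots n]. If it is 0, every [n e] and hence every
     coefficient is 0, so both sides vanish; otherwise it can be cancelled. *)
  rewrite -T0 mul0r big1 ?expr0n // => e _.
  by rewrite (admissible_sqrt_eq0 adm) // (totalShots_eq0 n_ge0).
rewrite -subr_ge0 -(pmulr_rge0 _ T_gt0) defect_sum_squares //.
by apply: sumr_ge0 => e _; rewrite divr_ge0 ?sqr_ge0.
Qed.

Lemma shots_err_eqP (R : rcfType) (E : nat) (TP TTheta : Type)
    (f : 'I_E -> TP -> TTheta -> R) (P : TP) (Theta : TTheta) (n : 'I_E -> R) :
  (forall e, 0 <= f e P Theta) -> admissible f P Theta n ->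
  let S := \sum_(e < E) Num.sqrt (f e P Theta) in
  totalShots n * Err f n P Theta = S ^+ 2 <->
  forall e, S * n e = totalShots n * Num.sqrt (f e P Theta).
Proof.
move=> f_ge0 adm S; have n_ge0 := admissible_ge0 adm.
have defect := defect_sum_squares f_ge0 adm; rewrite /= -/S in defect.
have := totalShots_ge0 n_ge0; rewrite le_eqVlt => /predU1P[T0|T_gt0].
  have s0 e : Num.sqrt (f e P Theta) = 0.
    by rewrite (admissible_sqrt_eq0 adm) // (totalShots_eq0 n_ge0).
  by rewrite -T0 /S big1 // expr0n mul0r; split=> // _ e; rewrite !mul0r.
split=> [eqS e|prop].
  move/eqP: defect; rewrite eqS subrr mulr0 eq_sym psumr_eq0; last first.
    by move=> i _; rewrite divr_ge0 ?sqr_ge0.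
  move=> /allP/(_ e); rewrite mem_index_enum => /(_ isT)/=.
  (* A vanishing summand has a zero numerator, or else [n e = 0] because the inverse of 0 is 0. *)
  rewrite mulf_eq0 invr_eq0 sqrf_eq0 => /orP[|/eqP n0].
    by rewrite subr_eq0 => /eqP.
  by rewrite n0 (admissible_sqrt_eq0 adm) ?mulr0.
apply/eqP; rewrite -subr_eq0 -(mulrI_eq0 _ (mulfI (lt0r_neq0 T_gt0))) defect.
by rewrite big1 // => e _; rewrite prop subrr expr0n mul0r.
Qed.

(** Summing the hypothesis over all configurations gives [totalShots n] as [c] times the sum of the
    [s i], which eliminates the unknown constant [c]. *)
Lemma prop_of_ratio (R : rcfType) (E : nat) (n s : 'I_E -> R) (c : R) :
  (forall e, n e = c * s e) ->
  forall e, (\sum_(i < E) s i) * n e = totalShots n * s e.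
Proof.
move=> ns e; rewrite /totalShots (eq_bigr _ (fun i _ => ns i)) -mulr_sumr ns.
ring.
Qed.

Lemma linearlyDependentP (R : rcfType) (E : nat) (u v : 'rV[R]_E) :
  linearlyDependent u v <-> v = 0 \/ exists k, u = k *: v.
Proof.
rewrite /linearlyDependent free_cons span_seq1 negb_and negbK seq1_free negbK.
split=> [/orP[/vlineP[k ->]|/eqP]|[->|[k ->]]].
- by right; exists k.
- by left.
- by rewrite eqxx orbT.
- by rewrite memvZ ?memv_line.
Qed.

Lemma linearlyDependent_shotsP (R : rcfType) (E : nat) (TP TTheta : Type)
    (f : 'I_E -> TP -> TTheta -> R) (P : TP) (Theta : TTheta) (n : 'I_E -> R) :
  (forall e, 0 <= f e P Theta) -> admissible f P Theta n ->
  linearlyDependent (\row_(e < E) Num.sqrt (n e))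
                    (\row_(e < E) Num.sqrt (f e P Theta / n e)) <->
  forall e, (\sum_(i < E) Num.sqrt (f i P Theta)) * n e
            = totalShots n * Num.sqrt (f e P Theta).
Proof.
move=> f_ge0 adm; have n_ge0 := admissible_ge0 adm.
have uv := mul_sqrt_div adm; set S := \sum_(i < E) _.
split=> [/linearlyDependentP[/rowP v0|[k /rowP uk]] | prop].
- have s0 e : Num.sqrt (f e P Theta) = 0.
    by have := v0 e; rewrite !mxE -(uv e) => ->; rewrite mulr0.
  by move=> e; rewrite /S big1 ?s0 ?mulr0 ?mul0r.
- apply: (@prop_of_ratio _ _ _ _ k) => e.
  (* Multiplying the coordinate equation of [u = k *: v] by the coordinate of [u] turns it into
     [n e = k * Num.sqrt (f e P Theta)]. *)
  rewrite -[in LHS](sqr_sqrtr (n_ge0 e)) expr2 -uv mulrCA; congr (_ * _).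
  by have := uk e; rewrite !mxE.
(* If [S = 0], all coefficients vanish and the second vector is zero. *)
apply/linearlyDependentP; have [S0|S_neq0] := eqVneq S 0.
  left; apply/rowP=> e; rewrite !mxE.
  have /eqP := psumr_eq0P (fun i _ => sqrtr_ge0 (f i P Theta)) S0 (erefl (_ e)).
  rewrite sqrtr_eq0 => f_le0.
  have -> : f e P Theta = 0 by apply/le_anti; rewrite f_le0 f_ge0.
  by rewrite mul0r sqrtr0.
(* The scalar is read off from the proportionality [S * n e = totalShots n * Num.sqrt (f e P
   Theta)]. *)
right; exists (totalShots n / S); apply/rowP=> e; rewrite !mxE.
case: (adm e) => [n_gt0|[-> ->]]; last by rewrite mul0r sqrtr0 mulr0.
have sn_neq0 : Num.sqrt (n e) != 0 by rewrite gt_eqF ?sqrtr_gt0.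
apply: (mulfI sn_neq0); rewrite mulrCA uv -expr2 sqr_sqrtr //.
by apply: (mulfI S_neq0); rewrite prop; field.
Qed.

Lemma sqrt_ratioE (R : rcfType) (x y : R) : 0 < x -> 0 < y ->
  Num.sqrt x / Num.sqrt (y / x) = x / Num.sqrt y.
Proof.
move=> x_gt0 y_gt0; rewrite sqrtrM ?ltW // sqrtrV ?ltW //.
rewrite -[in RHS](sqr_sqrtr (ltW x_gt0)); field.
by rewrite !gt_eqF ?sqrtr_gt0.
Qed.

Lemma sum_sqrt_gt0 (R : rcfType) (I : finType) (g : I -> R) :
  (exists i, 0 < g i) -> 0 < \sum_i Num.sqrt (g i).
Proof.
move=> [i g_gt0]; rewrite (bigD1 i) //= ltr_pwDl ?sqrtr_gt0 //.
by apply: sumr_ge0 => j _; apply: sqrtr_ge0.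
Qed.

Lemma Err_scale (R : rcfType) (E : nat) (TP TTheta : Type)
    (f : 'I_E -> TP -> TTheta -> R) (P : TP) (Theta : TTheta)
    (p : 'I_E -> R) (N : R) :
  Err f (fun e => N * p e) P Theta = Err f p P Theta / N.
Proof.
rewrite /Err mulr_suml; apply: eq_bigr => e _.
by rewrite !mul1r invfM -mulrA mulrC.
Qed.

(** Such a distribution assigns no shots exactly where the coefficient vanishes, which is the
    exception that [admissible] allows. *)
Lemma admissible_prop (R : rcfType) (E : nat) (TP TTheta : Type)
    (f : 'I_E -> TP -> TTheta -> R) (P : TP) (Theta : TTheta)
    (n : 'I_E -> R) (c : R) :
  (forall e, 0 <= f e P Theta) -> 0 < c ->
  (forall e, n e = c * Num.sqrt (f e P Theta)) -> admissible f P Theta n.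
Proof.
move=> f_ge0 c_gt0 nE e; rewrite nE.
have := f_ge0 e; rewrite le_eqVlt => /predU1P[<-|f_gt0].
  by right; rewrite sqrtr0 mulr0.
by left; rewrite mulr_gt0 ?sqrtr_gt0.
Qed.

(** The Cauchy-Schwarz bound is attained by the proportional distribution, so the minimum of [Err]
    is [S ^+ 2 / N] and being optimal means attaining it. *)
Lemma optimalShotsP (R : rcfType) (E : nat) (TP TTheta : Type)
    (f : 'I_E -> TP -> TTheta -> R) (P : TP) (Theta : TTheta)
    (N : R) (n : 'I_E -> R) :
  (forall e, 0 <= f e P Theta) -> (exists e, 0 < f e P Theta) -> 0 < N ->
  let S := \sum_(e < E) Num.sqrt (f e P Theta) in
  optimalShots f P Theta N n <->
  [/\ admissible f P Theta n, totalShots n = N & N * Err f n P Theta = S ^+ 2].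
Proof.
move=> f_ge0 f_gt0 N_gt0 S; have S_gt0 : 0 < S by apply: sum_sqrt_gt0.
split=> [[adm TN opt]|[adm TN eqS]]; split=> //.
  (* The competitor attaining the bound; the factor [N / S] makes its total equal to [N]. *)
  pose m e := N / S * Num.sqrt (f e P Theta).
  have mE e : m e = N / S * Num.sqrt (f e P Theta) by [].
  have admm : admissible f P Theta m.
    by apply: admissible_prop mE; rewrite ?divr_gt0.
  have Tm : totalShots m = N.
    by rewrite /totalShots -mulr_sumr divfK ?gt_eqF.
  have eqm : N * Err f m P Theta = S ^+ 2.
    by rewrite -Tm; apply/shots_err_eqP => //; apply: prop_of_ratio mE.
  (* One inequality is optimality of [n] against [m], the other is the lower bound applied to
     [n]. *)
  apply/le_anti; rewrite -{1}eqm ler_pM2l // opt //=.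
  by rewrite -[N in X in _ <= X]TN shots_err_ge.
move=> m admm Tm; rewrite -(ler_pM2l N_gt0) eqS -Tm.
exact: shots_err_ge.
Qed.

Theorem mainTheorem5 (R : rcfType) (E : nat) (TP TTheta : Type)
    (f : 'I_E -> TP -> TTheta -> R) (P : TP) (Theta : TTheta)
    (f_ge0 : forall e, 0 <= f e P Theta) :
  let S := \sum_(e < E) Num.sqrt (f e P Theta) in
  (* the lower bound *)
  (forall n : 'I_E -> R, admissible f P Theta n ->
     totalShots n * Err f n P Theta >= S ^+ 2)
  /\
  (* inverse proportionality to the total number of shots, both for any fixed
     relative shot distribution p and for the optimal distributions *)
  ((exists e, 0 < f e P Theta) ->
     (forall p : 'I_E -> R, admissible f P Theta p -> totalShots p = 1 ->
        exists2 C : R, 0 < C &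
          forall N : R, 0 < N -> Err f (fun e => N * p e) P Theta = C / N)
     /\
     (forall (N : R) (n : 'I_E -> R), 0 < N -> optimalShots f P Theta N n ->
        Err f n P Theta = S ^+ 2 / N))
  /\
  (* equality case: linear dependence *)
  (forall n : 'I_E -> R, admissible f P Theta n ->
     (totalShots n * Err f n P Theta = S ^+ 2 <->
      linearlyDependent (\row_(e < E) Num.sqrt (n e))
                        (\row_(e < E) Num.sqrt (f e P Theta / n e))))
  /\
  (* equality case: constant ratios, which require nonzero coefficients *)
  ((forall e, 0 < f e P Theta) ->
     forall n : 'I_E -> R, admissible f P Theta n ->
       (forall e, Num.sqrt (n e) / Num.sqrt (f e P Theta / n e)
                  = n e / Num.sqrt (f e P Theta))
       /\
       (totalShots n * Err f n P Theta = S ^+ 2 <->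
        exists c : R, forall e, 
          Num.sqrt (n e) / Num.sqrt (f e P Theta / n e) = c))
  /\
  (* the optimal shot distribution *)
  ((exists e, 0 < f e P Theta) ->
     forall (N : R) (n : 'I_E -> R), 0 < N ->
       (optimalShots f P Theta N n <->
        forall e, n e = N * (Num.sqrt (f e P Theta)
                             / \sum_(e' < E) Num.sqrt (f e' P Theta)))).
Proof.
move=> S; split=> [n adm|]; first exact: shots_err_ge.
split=> [f_gt0|].
  have S_gt0 : 0 < S by apply: sum_sqrt_gt0.
  split=> [p adm p1|N n N_gt0 /optimalShotsP[] // _ _ eqS]; last first.
    by rewrite -eqS mulrC mulKf // gt_eqF.
  (* The constant is the error at one shot in total; since [p] sums to 1, the lower bound gives at
     least [S ^+ 2], which is positive. *)
  exists (Err f p P Theta) => [|N _]; last exact: Err_scale.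
  rewrite -[Err _ _ _ _]mul1r -p1.
  by apply: lt_le_trans (shots_err_ge f_ge0 adm); rewrite exprn_gt0.
split=> [n adm|].
  by split=> [/shots_err_eqP|/linearlyDependent_shotsP] h;
    [apply/linearlyDependent_shotsP | apply/shots_err_eqP] => //; apply: h.
split=> [f_gt0 n adm|f_gt0 N n N_gt0].
  (* Positive coefficients rule out the zero-shot exception in [admissible], so the ratios have
     nonzero denominators. *)
  have n_gt0 e : 0 < n e.
    by case: (adm e) => // -[_ f0]; have := f_gt0 e; rewrite f0 ltxx.
  have ratio e := sqrt_ratioE (n_gt0 e) (f_gt0 e).
  have s_neq0 e : Num.sqrt (f e P Theta) != 0.
    by rewrite gt_eqF ?sqrtr_gt0.
  split=> //; split=> [/(shots_err_eqP f_ge0 adm) prop|[c cE]].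
    exists (totalShots n / S) => e; rewrite ratio.
    have S_neq0 : S != 0 by rewrite gt_eqF // sum_sqrt_gt0 //; exists e.
    by apply/eqP; rewrite eqr_div // mulrC prop.
  apply/(shots_err_eqP f_ge0 adm)/(@prop_of_ratio _ _ _ _ c) => e.
  by rewrite -(cE e) ratio divfK.
have S_gt0 : 0 < S by apply: sum_sqrt_gt0.
have S_neq0 : S != 0 by rewrite gt_eqF.
rewrite -/S; split=> [/optimalShotsP[] // adm TN eqS e|nE].
  rewrite -TN in eqS; have prop := (shots_err_eqP f_ge0 adm).1 eqS e.
  by rewrite mulrA -TN -prop mulrC mulKf.
(* Regrouped with constant ratio [N / S], the formula yields admissibility, the total [N] and
   equality in the bound, which together characterize optimality. *)
have nE' e : n e = N / S * Num.sqrt (f e P Theta) by rewrite nE mulrCA mulrC.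
have adm : admissible f P Theta n.
  by apply: admissible_prop nE'; rewrite ?divr_gt0.
have TN : totalShots n = N.
  by rewrite /totalShots (eq_bigr _ (fun e _ => nE' e)) -mulr_sumr divfK.
apply/optimalShotsP => //; split=> //; rewrite -TN.
by apply/shots_err_eqP => //; apply: prop_of_ratio nE'.
Qed.
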